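(* Let $(X_n,\tilde X_n,\sigma_n)$ be generated by the fixed trust region truncated Robbins-Monro algorithm (defined in the context) with open bounded sets $U_0\subsetneq U_1\subset\mathcal{H}$. Assume: (1) $f$ has a zero $x_\star$, and there exist $R_0<R_1$ such that $U_0\subseteq B_{R_0}(x_\star)\subset B_{R_1}(x_\star)\subseteq U_1$. (2) For any $0<a<A$ there exists $\delta>0$ such that $\inf\{\langle x-x_\star,f(x)\rangle : x\in U_1,\ a\le\|x-x_\star\|\le A\}\ge\delta$. (3) $x\mapsto\mathbb{E}[\|F(x,Z)\|^2]$ is bounded on $U_1$. (4) $a_n>0$ for all $n$, $\sum_n a_n=\infty$, and $\sum_n a_n^2<\infty$. Then, almost surely, $X_n\to x_\star$ in $\mathcal{H}$, and almost surely the number of truncations $\sup_n\sigma_n$ is finite.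
   Context: $(\mathcal{H},\langle\cdot,\cdot\rangle,\|\cdot\|)$ is a separable Hilbert space and $B_r(x)$ is the open ball of radius $r$ about $x$. $\chi$ is an auxiliary measurable space, $Z$ is a $\chi$-valued random variable with law $\mu_Z$, and $F:\mathcal{H}\times\chi\to\mathcal{H}$ is (jointly) measurable, with $f:\mathcal{H}\to\mathcal{H}$ given by $f(x)=\mathbb{E}[F(x,Z)]=\int_\chi F(x,z)\,\mu_Z(dz)$ for all $x\in\mathcal{H}$. $Z_1,Z_2,\dots$ are i.i.d. with law $\mu_Z$ and $(a_n)_{n\ge1}$ is a deterministic real sequence. Fixed trust region algorithm: given open bounded sets $U_0\subsetneq U_1$, an initial point $X_0\in U_0$ (independent of $(Z_n)$ if random) and $\sigma_0=0$, define for $n\ge0$ $$\tilde X_{n+1}=X_n-a_{n+1}F(X_n,Z_{n+1}),$$ and: if $\tilde X_{n+1}\in U_1$, then $X_{n+1}=\tilde X_{n+1}$ and $\sigma_{n+1}=\sigma_n$; if $\tilde X_{n+1}\notin U_1$ (a truncation), then $X_{n+1}=X_0^{(\sigma_n)}$ and $\sigma_{n+1}=\sigma_n+1$. The restart points $X_0^{(\sigma_n)}$ lie in $U_0$ and may be fixed or random, subject to $X_n$ being measurable with respect to $\mathcal{F}_n=\sigma(X_0,Z_1,\dots,Z_n)$ for every $n$; in particular $\mathbb{E}[F(X_n,Z_{n+1})\mid\mathcal{F}_n]=f(X_n)$. *)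

(* Defs.v *)
From HB Require Import structures.
From mathcomp Require Import all_boot all_order all_algebra finmap.
From mathcomp Require Import all_classical all_reals all_analysis.

Set Implicit Arguments.
Unset Strict Implicit.
Unset Printing Implicit Defensive.
Import Order.TTheory GRing.Theory Num.Theory.
Import numFieldNormedType.Exports.

Local Open Scope classical_set_scope.
Local Open Scope ring_scope.

(* The type H itself, equipped with its Borel sigma-algebra. *)
Definition borelType (R : realType) (H : normedModType R) :=
  g_sigma_algebraType (@open H).

Definition separable (T : topologicalType) :=
  exists2 D : set T, countable D & dense D.

Section bochner.
Context d (T : measurableType d) (R : realType) (H : normedModType R).
Variable mu : {finite_measure set T -> \bar R}.

(* Meaningful for s measurable with finite range; fine loses nothing since mu
   is finite. *)
Definition simple_integral (s : T -> H) : H :=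
  \sum_(y \in range s) fine (mu (s @^-1` [set y])) *: y.

(* g is Bochner integrable with integral v. Borel measurability of g and its
   usual strong measurability coincide when H is separable. *)
Definition bochner_integral_is (g : T -> H) (v : H) :=
  measurable_fun [set: T] (g : T -> borelType H) /\
  exists s : nat -> T -> H,
    [/\ forall n, measurable_fun [set: T] (s n : T -> borelType H),
        forall n, finite_set (range (s n)),
        (\int[mu]_z (`|g z - s n z|)%:E)%E @[n --> \oo] --> 0%E &
        simple_integral (s n) @[n --> \oo] --> v].

End bochner.

Section independence.
Context d (Omega : measurableType d) (R : realType) (P : probability Omega R).

Definition independent_sigma (G1 G2 : set (set Omega)) :=
  forall A B, G1 A -> G2 B -> P (A `&` B) = (P A * P B)%E.

Definition mutually_independent d' (T : measurableType d') (I : choiceType)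
    (Z : I -> Omega -> T) :=
  forall (J : {fset I}) (B : I -> set T),
    (forall i, i \in J -> measurable (B i)) ->
    P (\bigcap_(i in [set` J]) (Z i @^-1` B i)) =
    (\prod_(i <- J) P (Z i @^-1` B i))%E.

End independence.

Section generated.
Context d (Omega : measurableType d) d' (chi : measurableType d').

(* sigma(Z_1, Z_2, ...); the term of index 0 is not used. *)
Definition sigma_noise (Z : nat -> Omega -> chi) : set (set Omega) :=
  <<s \bigcup_(k in [set k | (1 <= k)%N]) g_sigma_algebra_preimage (Z k) >>.

(* sigma(X0, Z_1, ..., Z_n) *)
Definition sigma_history (R : realType) (H : normedModType R)
    (X0 : Omega -> H) (Z : nat -> Omega -> chi) (n : nat) : set (set Omega) :=
  <<s g_sigma_algebra_preimage (X0 : Omega -> borelType H) `|`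
      \bigcup_(k in [set k | (1 <= k <= n)%N]) g_sigma_algebra_preimage (Z k) >>.

End generated.

(* a, Z and Xt are indexed from 1, so their terms of index 0 are not
   constrained; Xr k is the restart point used at the truncation occurring when
   the counter sigma equals k. *)
Record fixed_trust_region (R : realType) (H : normedModType R)
    (Omega chi : Type) (F : H * chi -> H) (a : nat -> R) (U0 U1 : set H)
    (Z : nat -> Omega -> chi) (Xr X Xt : nat -> Omega -> H)
    (sigma : nat -> Omega -> nat) : Prop := FixedTrustRegion {
  ftr_init : forall w, U0 (X 0%N w) ;
  ftr_restart : forall k w, U0 (Xr k w) ;
  ftr_sigma0 : forall w, sigma 0%N w = 0%N ;
  ftr_trial : forall n w,
    Xt n.+1 w = X n w - a n.+1 *: F (X n w, Z n.+1 w) ;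
  ftr_accept : forall n w, U1 (Xt n.+1 w) ->
    X n.+1 w = Xt n.+1 w /\ sigma n.+1 w = sigma n w ;
  ftr_truncate : forall n w, ~ U1 (Xt n.+1 w) ->
    X n.+1 w = Xr (sigma n w) w /\ sigma n.+1 w = (sigma n w).+1
}.

(* Main.v *)
(* Write V_n = |X_n - xs|^2, and let W_n be the same quantity for the trial
   iterate. A truncation can only decrease it: the rejected trial point lies
   outside B_{R1}(xs) and the restart point inside B_{R0}(xs), so V_{n+1} <= W_n
   always and W_n - V_{n+1} >= R1^2 - R0^2 > 0 at a truncation. Expanding the
   square and integrating out Z_{n+1} (Tonelli, for fixed X_n) gives, on every
   event B of the past,
     int_B W_n + 2 a_{n+1} delta P(B, V_n >= r) <= int_B V_n + a_{n+1}^2 M.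
   With B the whole space this telescopes. The gaps W_n - V_{n+1} are therefore
   summable in mean, hence tend to 0 almost surely, so there are finitely many
   truncations. Also sum_n a_{n+1} P(V_n >= r) is finite, so E V_n is arbitrarily
   small for suitable n, as sum a_n = oo. Since V_n plus the tail of M sum a_k^2
   is a nonnegative supermartingale, the maximal inequality started from such n
   yields V_n -> 0 almost surely; no martingale convergence theorem is needed. *)
Require Import Defs.
From HB Require Import structures.
From mathcomp Require Import all_boot all_order all_algebra finmap.
From mathcomp Require Import all_classical all_reals all_analysis.
From mathcomp Require Import measurable_realfun lra ring.

Set Implicit Arguments.
Unset Strict Implicit.
Unset Printing Implicit Defensive.
Import Order.TTheory GRing.Theory Num.Theory.
Import numFieldNormedType.Exports.

Local Open Scope classical_set_scope.
Local Open Scope ring_scope.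

(** * Inner products and Borel measurability *)

Section hilbert.
Context (R : realType) (H : normedModType R) (dot : {dot H for idfun}).
Hypothesis norm_dot : forall x : H, `|x| = Num.sqrt (dot x x).

Lemma dotC x y : dot x y = dot y x.
Proof. by rewrite hermC /= expr0 mul1r. Qed.

Lemma dotxx x : dot x x = `|x| ^+ 2.
Proof.
rewrite norm_dot sqr_sqrtr //; have [->|x0] := eqVneq x 0.
  by rewrite linear0l.
exact/ltW/neq0_dnorm_gt0.
Qed.

Lemma normBZ_sqr x y (t : R) :
  `|x - t *: y| ^+ 2 = `|x| ^+ 2 - 2 * t * dot x y + t ^+ 2 * `|y| ^+ 2.
Proof.
rewrite -!dotxx linearBl !linearBr /= linearZl_LR !linearZr_LR linearZl_LR /=.
rewrite (dotC y x); ring.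
Qed.

(** Cauchy-Schwarz from the triangle inequality, which [H] already has as a normed space: comparing
    [|u + v|^2] with [(|u| + |v|)^2] isolates the cross term. *)
Lemma norm_dot_le x y : `|dot x y| <= `|x| * `|y|.
Proof.
have key u v : dot u v <= `|u| * `|v|.
  have := normBZ_sqr u v (-1).
  rewrite scaleN1r opprK => E.
  have : `|u + v| ^+ 2 <= (`|u| + `|v|) ^+ 2.
    by rewrite ler_sqr ?nnegrE// ?addr_ge0// ler_normD.
  rewrite E; nra.
rewrite ler_norml key andbT lerNl.
by rewrite -linearNl -(normrN x) key.
Qed.

Lemma continuous_dot x : continuous (dot x).
Proof.
move=> y; apply/cvgrPdist_le => e e0.
near=> z.
rewrite -linearBr (le_trans (norm_dot_le _ _))//.
have : `|x| * `|y - z| <= (`|x| + 1) * `|y - z| by rewrite ler_wpM2r// lerDl.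
move/le_trans; apply.
rewrite -ler_pdivlMl ?ltr_pwDr//.
near: z; apply: cvgr_dist_le; first exact: cvg_id.
by rewrite mulr_gt0 ?invr_gt0 ?ltr_pwDr.
Unshelve. all: by end_near. Qed.
End hilbert.

Section borel.
Context (R : realType) (H : normedModType R).

Lemma open_borel (A : set H) : open A -> measurable (A : set (borelType H)).
Proof. by move=> oA; exact: sub_sigma_algebra. Qed.

Lemma continuous_borel (K : normedModType R) (g : H -> K) :
  continuous g -> measurable_fun [set: borelType H] (g : borelType H -> borelType K).
Proof.
move=> /continuousP cg.
have := @measurability _ _ (borelType H) (borelType K) setT g (@open K) erefl.
apply => _ [A oA <-].
by rewrite setTI; apply: open_borel; exact: cg.
Qed.

Lemma continuous_measurable_real (g : H -> R) :
  continuous g -> measurable_fun [set: borelType H] (g : borelType H -> R).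
Proof.
move=> /continuousP cg.
apply: (measurability _ (RGenInftyO.measurableE R)).
move=> _ [_ [x ->] <-]; rewrite setTI; apply: open_borel; apply: cg.
exact: interval_open.
Qed.

Context d (T : measurableType d).

(* Separability: |u - v| < r iff |u - h| + |v - h| < r for some h in a countable
   dense set. Addition H * H -> H is thus never required to be measurable. *)
Lemma measurable_dist (u v : T -> borelType H) : separable H ->
  measurable_fun setT u -> measurable_fun setT v ->
  measurable_fun setT (fun w => `|(u w : H) - v w|).
Proof.
move=> [D cD dD] mu mv.
have md (h : H) (g : T -> borelType H) : measurable_fun setT g ->
    measurable_fun setT (fun w => `|(g w : H) - h|).
  move=> mg; apply: (measurableT_comp (f := fun y : borelType H => `|(y : H) - h|)) => //.
  apply: continuous_measurable_real => y.
  by apply: cvg_norm; apply: cvgB; [exact: cvg_id|exact: cvg_cst].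
apply: (measurability _ (RGenInftyO.measurableE R)).
move=> _ [_ [r ->] <-]; rewrite setTI.
rewrite [X in measurable X](_ : _ = \bigcup_(h in D)
    ((fun w => `|(u w : H) - h| + `|(v w : H) - h|) @^-1` `]-oo, r[)).
  rewrite bigcup_set_type; apply: countable_bigcupT_measurable => [|h].
    by rewrite (eq_countable (card_setT _)).
  rewrite -[X in measurable X]setTI.
  by apply: measurable_funD => //; exact: md.
apply/seteqP; split => [w /=|w [h _]] /=; rewrite !in_itv /=.
  (* With [h] within half the slack of [v w], the path from [u w] to [v w] through [h] exceeds
     [|u w - v w|] by less than the whole slack. *)
  move=> uvr; have e0 : 0 < (r - `|(u w : H) - v w|) / 2 by lra.
  have [||h [/= hv Dh]] := dD (ball (v w : H) ((r - `|(u w : H) - v w|) / 2)).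
  - by exists (v w); exact: ballxx.
  - exact: ball_open.
  exists h => //=; rewrite in_itv/=.
  have := ler_distD (v w : H) (u w) h.
  move: hv; rewrite -ball_normE/=; lra.
by have := ler_distD h (u w : H) (v w); rewrite (distrC h); lra.
Qed.

End borel.

(** * Bochner integrals tested against a vector *)

Section bochner_dot.
Context (R : realType) (H : normedModType R) (dot : {dot H for idfun}).
Hypothesis H_separable : separable H.
Hypothesis norm_dot : forall x : H, `|x| = Num.sqrt (dot x x).
Context d (T : measurableType d) (mu : {finite_measure set T -> \bar R}).

Lemma measurable_dot (y : H) (g : T -> borelType H) :
  measurable_fun setT g -> measurable_fun setT (fun z => dot y (g z)).
Proof.
move=> mg; apply: (measurableT_comp (f := fun h : borelType H => dot y h)) => //.
by apply: continuous_measurable_real; exact: continuous_dot.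
Qed.

Lemma integral_dot_simple (y : H) (s : T -> H) :
  measurable_fun setT (s : T -> borelType H) -> finite_set (range s) ->
  mu.-integrable setT (fun z => (dot y (s z))%:E) /\
  (\int[mu]_z (dot y (s z))%:E = (dot y (simple_integral mu s))%:E)%E.
Proof.
move=> ms fs.
have mpre h : measurable (s @^-1` [set h]).
  rewrite -[X in measurable X]setTI; apply: ms => //.
  have oC : open (~` [set h]).
    apply: closed_openC; apply: accessible_closed_set1.
    exact/hausdorff_accessible/norm_hausdorff.
  by rewrite -[X in measurable X]setCK; apply: measurableC; exact: open_borel.
(* At each [z] only the term [h = s z] survives, which reduces everything to integrals of
   indicators. *)
have sE z : ((dot y (s z))%:E =
    \sum_(h <- fset_set (range s)) (dot y h)%:E * (\1_(s @^-1` [set h]) z)%:E)%E.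
  rewrite (bigD1_seq (s z)) ?fset_uniq//=; last first.
    by rewrite in_fset_set// inE; exists z.
  rewrite indicE mem_set// mule1 big1 ?adde0// => h hs.
  rewrite indicE memNset ?mule0// => /= sh.
  by rewrite sh eqxx in hs.
have ii h : mu.-integrable setT
    (fun z => (dot y h)%:E * (\1_(s @^-1` [set h]) z)%:E)%E.
  by apply: integrableZl => //; exact: integrable_indic.
split.
  under eq_fun do rewrite sE.
  by apply: integrable_sum => //.
under eq_integral do rewrite sE.
rewrite integral_sum// /simple_integral fsbig_finite//= linear_sumr -sumEFin.
apply: eq_bigr => h _; rewrite integralZl//; last exact: integrable_indic.
rewrite integral_indic// setIT linearZr_LR/= EFinM fineK ?fin_num_measure//.
by rewrite muleC.
Qed.

(** The integrals of [dot y] along the simple approximations converge twice: to [dot y v] by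
    continuity, and to the integral of [dot y (g z)] because Cauchy-Schwarz bounds the error by
    [|y|] times the L1 distance. Uniqueness of limits concludes. *)
Lemma bochner_dot (y : H) (g : T -> H) (v : H) :
  bochner_integral_is mu g v -> (\int[mu]_z (`|g z|)%:E < +oo)%E ->
  mu.-integrable setT (fun z => (dot y (g z))%:E) /\
  (\int[mu]_z (dot y (g z))%:E = (dot y v)%:E)%E.
Proof.
move=> [mg [s [ms fs s0 sv]]] ig.
have mD (u : T -> H) : measurable_fun setT (u : T -> borelType H) ->
    measurable_fun setT (fun z => (`|u z|)%:E).
  move=> mu'; apply/measurable_EFinP.
  apply: (measurableT_comp (f := fun h : borelType H => `|(h : H)|)) => //.
  by apply: continuous_measurable_real; exact: norm_continuous.
have idg : mu.-integrable setT (fun z => (dot y (g z))%:E).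
  apply: (@le_integrable _ _ _ _ _ measurableT _ (fun z => `|y|%:E * `|g z|%:E)%E).
  - by apply/measurable_EFinP; exact: measurable_dot.
  - move=> z _; rewrite -EFinM /= lee_fin.
    by rewrite [leRHS]ger0_norm ?mulr_ge0//; exact: norm_dot_le.
  - apply: integrableZl => //; apply/integrableP; split; first exact: mD.
    by under eq_integral do rewrite /= normr_id.
split => //.
have mDs n : measurable_fun setT (fun z => (`|g z - s n z|)%:E).
  apply/measurable_EFinP; exact: measurable_dist.
have Is n := integral_dot_simple y (ms n) (fs n).
have lim1 : (\int[mu]_z (dot y (s n z))%:E)%E @[n --> \oo] --> (dot y v)%:E.
  under eq_fun do rewrite (Is _).2.
  apply: cvg_EFin; first by near=> n.
  by apply: cvg_comp sv _; exact: continuous_dot.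
suff lim2 : (\int[mu]_z (dot y (s n z))%:E)%E @[n --> \oo]
    --> (\int[mu]_z (dot y (g z))%:E)%E by exact: cvg_unique lim2 lim1.
have fg := integrable_fin_num measurableT idg.
rewrite -(fineK fg).
apply/fine_cvgP; split.
  by near=> n; rewrite (Is n).2.
apply/cvgrPdist_le => e e0.
(* Adding 1 to [|y|] keeps the denominator positive when [y = 0]. *)
have e1 : 0 < e / (`|y| + 1) by rewrite divr_gt0 ?ltr_pwDr.
move/fine_cvgP : s0 => [s0f /cvgrPdist_lt/(_ _ e1) s0].
near=> n.
have [idn In] := Is n.
rewrite -lee_fin -abse_EFin EFinB fineK// fineK ?In// -In -integralB//.
apply: le_trans (le_abse_integral _ _ _) _ => //.
  by apply: emeasurable_funB; [exact: measurable_int idg|exact: measurable_int idn].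
apply: (@le_trans _ _ (\int[mu]_z (`|y|%:E * `|g z - s n z|%:E))%E).
  apply: ge0_le_integral => //.
  - apply: measurableT_comp => //; apply: emeasurable_funB.
      exact: measurable_int idg.
    exact: measurable_int idn.
  - apply: measurable_funeM; exact: mDs.
  - move=> z _; rewrite -EFinB -EFinM -linearBr /= lee_fin.
    exact: norm_dot_le.
rewrite ge0_integralZl//.
have nf : (\int[mu]_z (`|g z - s n z|%:E))%E \is a fin_num by near: n.
rewrite -(fineK nf) -EFinM lee_fin.
have /= : fine (\int[mu]_z (`|g z - s n z|%:E))%E < e / (`|y| + 1).
  have : `|0 - fine (\int[mu]_z (`|g z - s n z|%:E))%E| < e / (`|y| + 1) by near: n.
  by rewrite sub0r normrN ger0_norm// fine_ge0// integral_ge0.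
rewrite ltr_pdivlMr ?ltr_pwDr// => h.
have : 0 <= fine (\int[mu]_z (`|g z - s n z|%:E))%E.
  by rewrite fine_ge0// integral_ge0.
nra.
Unshelve. all: by end_near. Qed.

End bochner_dot.

(* The measure structure of a pushforward takes a measurability proof that
   unification cannot find, hence this explicit packaging. *)
Lemma pack_finite_measure d (T : measurableType d) (R : realType)
    (m : set T -> \bar R) :
  m set0 = 0%E -> (forall A, 0 <= m A)%E -> semi_sigma_additive m ->
  fin_num_fun m ->
  exists m' : {finite_measure set T -> \bar R}, m' = m :> (set T -> \bar R).
Proof.
move=> m0 mge0 msa mfin.
pose m1 : {measure set T -> \bar R} := HB.pack m (isMeasure.Build _ _ _ m m0 mge0 msa).
pose m2 : {finite_measure set T -> \bar R} :=
  HB.pack m (Measure.on m1) (Measure_isFinite.Build _ _ _ m1 mfin).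
by exists m2.
Qed.

(** * Integrating out an independent variable *)

Section freezing.
Context d (Omega : measurableType d) (R : realType) (P : probability Omega R).
Context d1 (T1 : measurableType d1) d2 (T2 : measurableType d2).

(** Absorbs the event [B] into the measure, so that pushforwards and Tonelli apply on the whole
    space. *)
Lemma ge0_integral_mrestr (B : set Omega) (mB : measurable B) (g : Omega -> \bar R) :
  measurable_fun setT g -> (forall w, 0 <= g w)%E ->
  (\int[mrestr P mB]_w g w = \int[P]_(w in B) g w)%E.
Proof.
move=> mg g0; have mC := measurableC mB.
rewrite (ge0_negligible_integral mC)//; last by rewrite /= /mrestr setICl measure0.
rewrite setTD setCK; apply: eq_measure_integral => A mA AB.
by rewrite /= /mrestr setIidl.
Qed.

(** Under [P] restricted to [B], the law of [(X, Y)] is the law of [X] times [mu]: the factorization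
    hypothesis says so on rectangles, and uniqueness of the product measure does the rest. Tonelli
    then integrates out [Y]. Letting [B] range over past events replaces conditional expectation. *)
Lemma integral_freezing (X : Omega -> T1) (Y : Omega -> T2)
    (mu : probability T2 R) (B : set Omega) (phi : T1 * T2 -> \bar R) :
  measurable_fun setT X -> measurable_fun setT Y -> measurable B ->
  (forall A C, measurable A -> measurable C ->
    P (B `&` X @^-1` A `&` Y @^-1` C) = P (B `&` X @^-1` A) * mu C)%E ->
  measurable_fun setT phi -> (forall x, 0 <= phi x)%E ->
  (\int[P]_(w in B) phi (X w, Y w) =
   \int[P]_(w in B) \int[mu]_z phi (X w, z))%E.
Proof.
move=> mX mY mB ind mphi phi0.
have mXY : measurable_fun setT (fun w => (X w, Y w)) by exact: measurable_fun_pair.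
have mF : measurable_fun setT (fubini_F mu phi).
  exact: measurable_fun_fubini_tonelli_F.
rewrite -(ge0_integral_mrestr mB (g := fun w => phi (X w, Y w)))//; last first.
  exact: (measurableT_comp mphi).
rewrite -(ge0_integral_mrestr mB (g := fun w => \int[mu]_z phi (X w, z))%E); last 2 first.
- exact: (measurableT_comp mF).
- by move=> w; exact: integral_ge0.
have mpre d' (T : measurableType d') (g : Omega -> T) A :
    measurable_fun setT g -> measurable A -> measurable (g @^-1` A).
  by move=> mg mA; rewrite -[X in measurable X]setTI; exact: mg.
have pushE d' (T : measurableType d') (g : Omega -> T) : measurable_fun setT g ->
    exists m : {finite_measure set T -> \bar R},
      m = pushforward (mrestr P mB) g :> (set T -> \bar R).
  move=> mg; apply: pack_finite_measure.
  - exact: measure0.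
  - by move=> A; exact: measure_ge0.
  - exact: measure_semi_sigma_additive.
  - move=> A mA; rewrite /pushforward /mrestr fin_num_measure//.
    by apply: measurableI => //; exact: mpre.
have [J JE] := pushE _ _ _ mXY; have [nu nuE] := pushE _ _ _ mX.
have prodE A : measurable A -> (nu \x mu)%E A = J A.
  apply: product_measure_unique => U V mU mV.
  transitivity (pushforward (mrestr P mB) X U * mu V)%E; last by rewrite -nuE.
  transitivity (pushforward (mrestr P mB) (fun w => (X w, Y w)) (U `*` V)).
    by rewrite -JE.
  rewrite /pushforward /mrestr [X in (P X * _)%E]setIC -ind//; congr (P _).
  by apply/seteqP; split => w /=; tauto.
rewrite -(@ge0_integral_pushforward _ _ _ _ _ _ mXY (mrestr P mB) setT)//.
rewrite -(@ge0_integral_pushforward _ _ _ _ _ _ mX (mrestr P mB) setT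
  (fubini_F mu phi))//; last first.
  by move=> x _; exact: integral_ge0.
rewrite -JE -nuE -fubini_tonelli1//.
by apply: eq_measure_integral => A mA _; apply/esym; exact: prodE.
Qed.

End freezing.

(** * Independence of the history and the next noise *)

Section history.
Context d (Omega : measurableType d) (R : realType) (P : probability Omega R).
Context d' (chi : measurableType d') (H : normedModType R).
Variables (Z : nat -> Omega -> chi) (X0 : Omega -> H).
Hypothesis mZ : forall n, measurable_fun setT (Z n).
Hypothesis Z_indep : mutually_independent P (fun n : nat => Z n.+1).
Hypothesis mX0 : measurable_fun setT (X0 : Omega -> borelType H).
Hypothesis X0_indep : independent_sigma P
  (g_sigma_algebra_preimage (X0 : Omega -> borelType H)) (sigma_noise Z).

Lemma measurable_history n B : sigma_history X0 Z n B -> measurable B.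
Proof.
apply: smallest_sub; first exact: sigma_algebra_measurable.
move=> A [[C mC <-]|[k _ [C mC <-]]].
  exact: mX0.
exact: mZ.
Qed.

Lemma sub_history n : sigma_history X0 Z n `<=` sigma_history X0 Z n.+1.
Proof.
apply: sub_sigma_algebra2 => A [XA|[k /= /andP[k1 kn] ZA]]; first by left.
by right; exists k => //=; rewrite k1 (leq_trans kn).
Qed.

Lemma noise_indep (n : nat) (C : nat -> set chi) : (forall i, measurable (C i)) ->
  P ((\bigcap_(i < n.+1) Z i.+1 @^-1` C i)) =
  (P (\bigcap_(i < n) Z i.+1 @^-1` C i) * P (Z n.+1 @^-1` C n))%E.
Proof.
move=> mC.
have prodE m : P (\bigcap_(i < m) Z i.+1 @^-1` C i) =
    (\prod_(i < m) P (Z i.+1 @^-1` C i))%E.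
  have := @Z_indep (fset_set `I_m) C (fun i _ => mC i).
  rewrite fset_setK// => ->.
  rewrite -(fsbig_finite _ (fun i => P (Z i.+1 @^-1` C i)))//.
  by rewrite -fsbig_ord.
by rewrite !prodE big_ord_recr.
Qed.

(** A pi-lambda argument. The events [G], which constrain [X0] and each of [Z 1], ..., [Z n]
    separately, are stable under intersection and generate the history; the events independent of
    [E] form a Dynkin system containing them. *)
Lemma history_indep n (B : set Omega) (C : set chi) :
  sigma_history X0 Z n B -> measurable C ->
  (P (B `&` Z n.+1 @^-1` C) = P B * P (Z n.+1 @^-1` C))%E.
Proof.
move=> hB mC; pose E := Z n.+1 @^-1` C.
have mZpre k D : measurable D -> measurable (Z k @^-1` D).
  by move=> mD; rewrite -[X in measurable X]setTI; exact: mZ.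
have mE : measurable E by exact: mZpre.
pose G : set (set Omega) := [set A | exists A0 D,
  [/\ g_sigma_algebra_preimage (X0 : Omega -> borelType H) A0,
      forall i, measurable (D i : set chi) &
      A = A0 `&` \bigcap_(i < n) Z i.+1 @^-1` D i]].
have GI : setI_closed G.
  move=> _ _ [A [D [gA mD ->]]] [A' [D' [gA' mD' ->]]].
  exists (A `&` A'), (fun i => D i `&` D' i); split.
  - exact: (@measurableI _ (g_sigma_algebra_preimageType (X0 : Omega -> borelType H))).
  - by move=> i; exact: measurableI.
  - by rewrite setIACA -bigcapI.
have genG : sigma_history X0 Z n `<=` <<s G >>.
  apply: smallest_sub; first exact: smallest_sigma_algebra.
  move=> A [gA|[[//|k] /= kn [D mD <-]]]; apply: sub_sigma_algebra.
    exists A, (fun=> setT); split => //.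
    by rewrite (_ : \bigcap_(i < n) _ = setT) ?setIT// bigcapT.
  exists setT, (fun i => if i == k then D else setT); split.
  - exact: (@measurableT _ (g_sigma_algebra_preimageType (X0 : Omega -> borelType H))).
  - by move=> i; case: ifP.
  - rewrite !setTI; apply/seteqP; split => w /= Dw.
      by move=> i _ /=; case: eqP => [->|].
    by have := Dw k kn; rewrite /= eqxx.
have mG A : <<s G >> A -> measurable A.
  apply: smallest_sub; first exact: sigma_algebra_measurable.
  move=> _ [A0 [D [[U mU <-] mD ->]]]; apply: measurableI; first exact: mX0.
  by apply: bigcap_measurableType => i _; exact: mZpre.
pose L : set (set Omega) := [set A | measurable A /\ (P (A `&` E) = P A * P E)%E].
suff GL : <<s G >> `<=` L by have [] := GL _ (genG _ hB).
apply: (@lambda_system_subset _ _ GI setT) => //.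
  apply/dynkin_lambda_system; split.
  - by split; [exact: measurableT|rewrite setTI probability_setT mul1e].
  - move=> A [mA AE]; split; first exact: measurableC.
    rewrite setIC -setDE measureD//; last first.
      by rewrite (le_lt_trans (probability_le1 _ _)) ?ltry.
    rewrite [X in (_ - X)%E](_ : _ = P A * P E)%E; last first.
      by rewrite setIC; exact: AE.
    rewrite probability_setC// muleBl ?mul1e//.
    by rewrite fin_num_measure.
  - move=> F tF LF; have mF i : measurable (F i) := (LF i).1.
    split; first exact: bigcupT_measurable.
    rewrite setI_bigcupl measure_bigcup//; last 2 first.
    + by move=> i _; exact: measurableI.
    + exact: trivIset_setIr.
    rewrite measure_bigcup// muleC -(fineK (fin_num_measure P _ mE)) -nneseriesZl//.
    by apply: eq_eseriesr => i _; rewrite fineK ?fin_num_measure// muleC; exact: (LF i).2.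
move=> _ [A0 [D [gA mD ->]]]; split.
  apply: mG; apply: sub_sigma_algebra; exists A0, D; split => //.
(* Prescribing [C] at index [n] turns [E] into one more noise constraint, so the intersections with
   and without [E] are both noise events, to which [X0_indep] applies. *)
pose D' i := if i == n then C else D i.
have mD' i : measurable (D' i) by rewrite /D'; case: ifP.
have bigD : \bigcap_(i < n) Z i.+1 @^-1` D' i = \bigcap_(i < n) Z i.+1 @^-1` D i.
  by apply: eq_bigcapr => i /= ni; rewrite /D' lt_eqF.
have noise m : sigma_noise Z (\bigcap_(i < m) Z i.+1 @^-1` D' i).
  have := @bigcap_measurableType _ (g_sigma_algebraType
    (\bigcup_(k in [set k | (1 <= k)%N]) g_sigma_algebra_preimage (Z k)))
    (fun i => Z i.+1 @^-1` D' i) `I_m.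
  apply => i _; apply: sub_sigma_algebra; exists i.+1 => //.
  by exists (D' i); rewrite ?setTI.
have DE : (\bigcap_(i < n) Z i.+1 @^-1` D i) `&` E = \bigcap_(i < n.+1) Z i.+1 @^-1` D' i.
  rewrite IIS bigcap_setU bigcap_set1 bigD; congr (_ `&` _).
  by rewrite /D' eqxx.
rewrite -setIA DE (X0_indep gA (noise _)) noise_indep// bigD.
by rewrite -bigD (X0_indep gA (noise _)) {2}/D' eqxx muleA.
Qed.

End history.

(** * Real series and the deterministic drift argument *)

Lemma seriesS_add (V : zmodType) (u : V^nat) n : series u n.+1 = series u n + u n.
Proof. by rewrite /series/= big_nat_recr. Qed.

Lemma series_ge0_le_lim (R : realType) (u : R^nat) n :
  (forall n, 0 <= u n) -> cvgn (series u) -> series u n <= limn (series u).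
Proof.
by move=> u0 cu; apply: nondecreasing_cvgn_le cu _; exact/nondecreasing_series.
Qed.

(** Otherwise, once the tail of [beta] is below [e / 4], [v n] exceeds [3e/4], so the last
    hypothesis at [r = e / 4] keeps [p r n] above a fixed [eta]. Each step then loses at least
    [alpha n * delta * eta], up to [beta n], and divergence of [series alpha] makes [v] negative. *)
Lemma mean_plus_tail_small (R : realType) (v alpha beta : R^nat) (p : R -> R^nat) (K : R) :
  0 < K -> (forall n, 0 <= v n) -> (forall n, 0 <= alpha n) ->
  (forall n, 0 <= beta n) ->
  series alpha @ \oo --> +oo -> cvgn (series beta) ->
  (forall r, 0 < r -> exists2 delta, 0 < delta &
    forall n, v n.+1 + alpha n * delta * p r n <= v n + beta n) ->
  (forall r n, 0 < r -> v n <= r + K * p r n) ->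
  forall e, 0 < e -> exists m, v m + (limn (series beta) - series beta m) < e.
Proof.
move=> K0 v0 a0 b0 aoo cb drift vp e e0.
have e4 : 0 < e / 4 by rewrite divr_gt0.
have [delta delta0 dr] := drift _ e4.
pose eta := e / 4 / K; have eta0 : 0 < eta by rewrite divr_gt0.
have /cvgrPdist_lt/(_ _ e4)[m0 _ tail] := cb.
have {}tail n : (m0 <= n)%N -> limn (series beta) - series beta n < e / 4.
  by move=> /tail /=; apply: le_lt_trans; exact: ler_norm.
apply: contrapT => /forallNP small.
have pn n : (m0 <= n)%N -> eta <= p (e / 4) n.
  move=> mn; have /negP := small n; rewrite -leNgt => vn.
  have := vp (e / 4) n e4; have := tail _ mn => tn vpn.
  rewrite /eta ler_pdivrMr// [leRHS]mulrC; lra.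
clearbody eta.
have sum k : v (m0 + k)%N + delta * eta * (series alpha (m0 + k)%N - series alpha m0)
    <= v m0 + (series beta (m0 + k)%N - series beta m0).
  elim: k => [|k ih]; first by rewrite addn0 !subrr mulr0.
  rewrite addnS !seriesS_add.
  have drk := dr (m0 + k)%N.
  have : alpha (m0 + k)%N * delta * eta <= alpha (m0 + k)%N * delta * p (e / 4) (m0 + k)%N.
    by rewrite ler_wpM2l ?pn ?leq_addr// mulr_ge0// ltW.
  move: ih drk => /=; move: (series alpha _) (series alpha _) => A B; nra.
have de0 : 0 < delta * eta by rewrite mulr_gt0.
(* Beyond this threshold the accumulated loss exceeds [v m0] plus all that [beta] can still add. *)
move/cvgryPgt : aoo => /(_ (series alpha m0 + (v m0 + e / 4) / (delta * eta)))[m1 _ big].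
have := big (m0 + m1)%N (leq_addl _ _); rewrite /= -ltrBrDl ltr_pdivrMr//.
have := sum m1; have := v0 (m0 + m1)%N; have := tail m0 (leqnn _).
have := series_ge0_le_lim (m0 + m1) b0 cb.
lra.
Qed.

(** * Almost supermartingales with a restoring drift *)

Section supermartingale.
Context d (Omega : measurableType d) (R : realType) (P : probability Omega R).
(* W n plays the role of V n.+1 before truncation. *)
Variables (V W : nat -> Omega -> R) (G : nat -> set (set Omega)).
Variables (alpha beta : R^nat) (K : R).
Hypothesis mV : forall n, measurable_fun setT (V n).
Hypothesis mW : forall n, measurable_fun setT (W n).
Hypothesis V_ge0 : forall n w, 0 <= V n w.
Hypothesis V_leK : forall n w, V n w <= K.
Hypothesis V_le_W : forall n w, V n.+1 w <= W n w.
Hypothesis G_measurable : forall n B, G n B -> measurable B.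
Hypothesis G_setT : forall n, G n setT.
Hypothesis G_setI : forall n A B, G n A -> G n B -> G n (A `&` B).
Hypothesis G_nondecreasing : forall n, G n `<=` G n.+1.
Hypothesis V_adapted : forall n t, G n [set w | V n w < t].
Hypothesis alpha_ge0 : forall n, 0 <= alpha n.
Hypothesis beta_ge0 : forall n, 0 <= beta n.
Hypothesis alpha_sum : series alpha @ \oo --> +oo.
Hypothesis beta_sum : cvgn (series beta).
Hypothesis drift : forall r, 0 < r -> exists2 delta, 0 < delta &
  forall n B, G n B ->
    (\int[P]_(w in B) (W n w)%:E + (alpha n * delta)%:E * P (B `&` [set w | (r <= V n w)%R])
     <= \int[P]_(w in B) (V n w)%:E + (beta n)%:E)%E.

(** On measurable sets [fine] loses nothing, as [V] is bounded by [K]; real values let linear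
    arithmetic settle the estimates. *)
Let v n B := fine (\int[P]_(w in B) (V n w)%:E)%E.
Let p A := fine (P A).
Let K0 : 0 <= K.
Proof. exact: le_trans (V_ge0 0 point) (V_leK 0 point). Qed.

Let mEV n B : measurable_fun B (EFin \o V n).
Proof. by apply/measurable_EFinP; exact: measurable_funTS. Qed.
Let mEW n B : measurable_fun B (EFin \o W n).
Proof. by apply/measurable_EFinP; exact: measurable_funTS. Qed.

Let mgeV n r : measurable [set w | r <= V n w].
Proof.
rewrite (_ : [set w | _] = ~` [set w | V n w < r]).
  exact/measurableC/G_measurable/V_adapted.
by apply/seteqP; split => w /=; rewrite leNgt => /negP.
Qed.

Let intV_le n B : measurable B -> (\int[P]_(w in B) (V n w)%:E <= K%:E * P B)%E.
Proof.
move=> mB; rewrite -integral_cst//; apply: ge0_le_integral => //.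
- by move=> w _; rewrite lee_fin.
- exact: mEV.
- by move=> w _; rewrite lee_fin V_leK.
Qed.

Let intVE n B : measurable B -> (\int[P]_(w in B) (V n w)%:E)%E = (v n B)%:E.
Proof.
move=> mB; rewrite fineK// ge0_fin_numE; last first.
  by apply: integral_ge0 => w _; rewrite lee_fin.
apply: le_lt_trans (intV_le _ mB) _.
by rewrite lte_mul_pinfty// -?ge0_fin_numE// fin_num_measure.
Qed.

Let pE A : measurable A -> P A = (p A)%:E.
Proof. by move=> mA; rewrite fineK// fin_num_measure. Qed.

Let v_ge0 n B : 0 <= v n B.
Proof. by rewrite fine_ge0// integral_ge0// => w _; rewrite lee_fin. Qed.

Let intWV n B : G n B -> (\int[P]_(w in B) (V n.+1 w)%:E <= \int[P]_(w in B) (W n w)%:E)%E.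
Proof.
move=> /G_measurable mB; apply: ge0_le_integral => //.
- by move=> w _; rewrite lee_fin.
- exact: mEV.
- exact: mEW.
- by move=> w _; rewrite lee_fin V_le_W.
Qed.

Let drift_real r : 0 < r -> exists2 delta, 0 < delta & forall n B, G n B ->
  v n.+1 B + alpha n * delta * p (B `&` [set w | r <= V n w]) <= v n B + beta n.
Proof.
move=> r0; have [delta delta0 dr] := drift r0; exists delta => // n B GB.
have mB := G_measurable GB.
rewrite -lee_fin !EFinD EFinM -!intVE// -pE//; last exact: measurableI.
by apply: le_trans (dr n B GB); rewrite leeD2r// intWV.
Qed.

Let vS n B : G n B -> v n.+1 B <= v n B + beta n.
Proof.
(* Any positive level would do in place of 1, since the drift term is dropped. *)
move=> GB; have [delta delta0 /(_ n B GB)] := drift_real ltr01.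
apply: le_trans; rewrite lerDl mulr_ge0 ?fine_ge0//.
by rewrite mulr_ge0// ltW.
Qed.

Let v_setD n B r : measurable B ->
  v n B = v n (B `&` [set w | r <= V n w]) + v n (B `\` [set w | r <= V n w]).
Proof.
move=> mB.
have mBg : measurable (B `&` [set w | r <= V n w]) by exact: measurableI.
have mBD : measurable (B `\` [set w | r <= V n w]) by exact: measurableD.
apply: EFin_inj; rewrite EFinD -!intVE// -ge0_integral_setU//.
- by rewrite setUIDK.
- exact: mEV.
- by move=> w _; rewrite lee_fin.
- by apply/disj_setPS => w [[_ Vr] [_ /(_ Vr)]].
Qed.

Let v_le n B c : measurable B -> 0 <= c -> (forall w, B w -> V n w <= c) -> v n B <= c * p B.
Proof.
move=> mB c0 Vc; rewrite -lee_fin EFinM -intVE// -pE// -integral_cst//.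
apply: ge0_le_integral => //.
- by move=> w _; rewrite lee_fin.
- exact: mEV.
Qed.

Let v_ge n B c : measurable B -> 0 <= c -> (forall w, B w -> c <= V n w) -> c * p B <= v n B.
Proof.
move=> mB c0 Vc; rewrite -lee_fin EFinM -intVE// -pE// -integral_cst//.
by apply: ge0_le_integral => //; exact: mEV.
Qed.

(** Split at level [r]: below it [V] contributes at most [r], above it [V] is at most [K]. *)
Let v_tail n r : 0 < r -> v n setT <= r + K * p [set w | r <= V n w].
Proof.
move=> r0; rewrite (v_setD n r measurableT) setTI setTD addrC lerD//.
  rewrite -[leRHS]mulr1 (@le_trans _ _ (r * p (~` [set w | r <= V n w])))//.
    apply: v_le; [exact: measurableC|exact: ltW|].
    by move=> w /= /negP; rewrite -ltNge => /ltW.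
  rewrite ler_wpM2l ?(ltW r0)// -lee_fin -pE ?probability_le1//.
    exact: measurableC.
  exact: measurableC.
by apply: v_le.
Qed.

(** Stands in for a stopping time: the complement says that, from time [m] on, [V] reaches [t]
    before time [m + k]. *)
Let stay t m k := [set w | forall j, (j < k)%N -> V (m + j)%N w < t].

Let stayS t m k : stay t m k.+1 = stay t m k `\` [set w | t <= V (m + k)%N w].
Proof.
apply/seteqP; split => w /= sw.
  split => [j jk|]; first by rewrite sw// ltnW.
  by apply/negP; rewrite -ltNge sw.
move=> j; rewrite ltnS leq_eqVlt => /orP[/eqP->|]; last exact: sw.1.
by rewrite ltNge; apply/negP; exact: sw.2.
Qed.

Let G_stay t m k : G (m + k)%N (stay t m k.+1).
Proof.
elim: k => [|k ih].
  rewrite (_ : stay t m 1 = [set w | V (m + 0)%N w < t]); first exact: V_adapted.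
  apply/seteqP; split => w /= sw; first exact: sw.
  by move=> j; rewrite ltnS leqn0 => /eqP ->.
rewrite stayS setDE addnS; apply: G_setI.
  exact: G_nondecreasing.
rewrite (_ : ~` _ = [set w | V (m + k).+1 w < t]); first exact: V_adapted.
by apply/seteqP; split => w /=; rewrite ltNge => /negP.
Qed.

Let m_stay t m k : measurable (stay t m k).
Proof.
case: k => [|k]; last exact: G_measurable (G_stay t m k).
by rewrite (_ : stay t m 0 = setT)//; apply/seteqP; split => w.
Qed.

(* The maximal inequality, by telescoping over the first time V reaches t. *)
Let stay_maximal t m k : 0 < t ->
  t * p (~` stay t m k) + v (m + k)%N (stay t m k) <=
  v m setT + (series beta (m + k)%N - series beta m).
Proof.
move=> t0; elim: k => [|k ih].
  rewrite (_ : stay t m 0 = setT); last by apply/seteqP; split => w.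
  by rewrite setCT addn0 subrr /p measure0 mulr0 add0r addr0.
rewrite addnS seriesS_add.
have := vS (G_stay t m k).
have := v_setD (m + k) t (m_stay t m k); rewrite -stayS.
have mI : measurable (stay t m k `&` [set w | t <= V (m + k)%N w]) by exact: measurableI.
(* Paths reaching [t] for the first time at [m + k] carry at least [t] times their probability of
   the mean, which pays for the growth of the first term. *)
have := v_ge (c := t) mI (ltW t0) (fun w h => h.2).
have : p (~` stay t m k.+1) = p (~` stay t m k) + p (stay t m k `&` [set w | t <= V (m + k)%N w]).
  have mC := measurableC (m_stay t m k).
  apply: EFin_inj; rewrite EFinD -!pE//; last exact/measurableC/m_stay.
  rewrite -measureU//.
    by rewrite stayS setDE setCI setCK setUIr setvU setTI.
  by rewrite setIA setICl set0I.
move=> ->; rewrite mulrDr; lra.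
Qed.

Let limsup_null t m : 0 < t -> (t%:E * P (\bigcup_k ~` stay t m k) <=
  (v m setT + (limn (series beta) - series beta m))%:E)%E.
Proof.
move=> t0.
have mC k : measurable (~` stay t m k) by exact: measurableC.
have mU : measurable (\bigcup_k ~` stay t m k) by exact: bigcup_measurable.
rewrite pE// -EFinM lee_fin mulrC -ler_pdivlMr// -lee_fin -pE//.
have ndC : nondecreasing_seq (fun k => ~` stay t m k).
  move=> i j ij; apply/subsetPset; apply: subsetC => w sw l li.
  exact/sw/(leq_trans li).
have := nondecreasing_cvg_mu (mu := P) mC mU ndC.
move=> /cvg_lim <-//; apply: lime_le.
  by apply: cvgP; exact: nondecreasing_cvg_mu.
apply: nearW => k /=; rewrite pE// lee_fin ler_pdivlMr// mulrC.
have := stay_maximal m k t0; have := v_ge0 (m + k)%N (stay t m k).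
have := series_ge0_le_lim (m + k)%N beta_ge0 beta_sum.
lra.
Qed.

Lemma supermartingale_cvg0 : {ae P, forall w, V n w @[n --> \oo] --> 0}.
Proof.
have small : forall e, 0 < e ->
    exists m, v m setT + (limn (series beta) - series beta m) < e.
  (* The constant must be positive while [K] may vanish, hence [K + 1]. *)
  apply: (@mean_plus_tail_small _ _ _ _ (fun r n => p [set w | r <= V n w]) (K + 1)) => //.
  - by rewrite ltr_wpDl.
  - move=> r r0; have [delta delta0 dr] := drift_real r0.
    by exists delta => // n; have := dr n setT (G_setT n); rewrite setTI.
  - move=> r n r0; apply: le_trans (v_tail n r0) _.
    by rewrite lerD2l ler_wpM2r ?fine_ge0// lerDl.
have null i : {ae P, forall w, exists m, forall k, stay (i.+1%:R^-1) m k w}.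
  have t0 : 0 < i.+1%:R^-1 :> R by rewrite invr_gt0.
  (* [N] is the event that [V] reaches the level after every time [m]. If it had positive
     probability, a starting time [m] with mean plus tail below level times probability would
     contradict [limsup_null]. *)
  pose N := \bigcap_m \bigcup_k ~` stay (i.+1%:R^-1) m k.
  have mU m : measurable (\bigcup_k ~` stay (i.+1%:R^-1) m k).
    by apply: bigcup_measurable => k _; exact: measurableC.
  have mN : measurable N by exact: bigcap_measurable.
  exists N; split => //; last first.
    move=> w /= /forallNP nw m _; have /existsNP[k nk] := nw m.
    by exists k.
  apply/eqP; rewrite eq_le measure_ge0 andbT pE// lee_fin leNgt; apply/negP => p0.
  have [m] := small _ (mulr_gt0 t0 p0); rewrite ltNge => /negP; apply.
  rewrite -lee_fin; apply: le_trans (limsup_null m t0).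
  rewrite EFinM -pE// lee_pmul2l// le_measure ?inE//.
  exact: bigcap_inf.
have := ae_foralln null; apply: filterS => w sw.
apply/cvgrPdist_lt => e e0.
have [i ie] : exists i, i.+1%:R^-1 < e.
  have := near_infty_natSinv_lt (PosNum e0) => -[i _ /(_ i (leqnn _))] /= ie.
  by exists i.
have [m mk] := sw i; near=> n.
rewrite sub0r normrN ger0_norm// (lt_trans _ ie)//.
have mn : (m <= n)%N by near: n; exact: nbhs_infty_ge.
by have := mk (n - m).+1 (n - m)%N; rewrite subnKC//; apply.
Unshelve. all: by end_near. Qed.

(** Telescoping bounds the summed means of the gaps by [v 0 setT] plus the total of [beta]. The
    series of gaps thus has finite mean, is finite almost surely, and its terms tend to 0. *)
Lemma supermartingale_gap_cvg0 : {ae P, forall w, (W n w - V n.+1 w) @[n --> \oo] --> 0}.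
Proof.
pose D n w := W n w - V n.+1 w.
have D0 n w : 0 <= D n w by rewrite subr_ge0.
have mD n : measurable_fun setT (EFin \o D n).
  by apply/measurable_EFinP; exact: measurable_funB.
have stepD n : ((v n.+1 setT)%:E + \int[P]_w (D n w)%:E <= (v n setT + beta n)%:E)%E.
  rewrite -intVE// -ge0_integralD//; last 4 first.
  - by move=> w _; rewrite lee_fin.
  - exact: mEV.
  - by move=> w _; rewrite lee_fin.
  - exact: mD.
  rewrite EFinD -intVE//.
  have [delta delta0 /(_ n setT (G_setT n))] := drift ltr01.
  apply: le_trans; rewrite setTI.
  rewrite (eq_integral (EFin \o W n)).
    by rewrite leeDl// mule_ge0// lee_fin mulr_ge0// ltW.
  by move=> w _ /=; rewrite -EFinD /D addrC subrK.
have DE n : (\int[P]_w (D n w)%:E)%E \is a fin_num.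
  rewrite ge0_fin_numE; last by apply: integral_ge0 => w _; rewrite lee_fin.
  apply: le_lt_trans (ltry (v n setT + beta n)); apply: le_trans (stepD n).
  by rewrite leeDr// lee_fin.
have sumD n : (\sum_(0 <= k < n) \int[P]_w (D k w)%:E <=
    (v 0 setT + limn (series beta))%:E)%E.
  suff : (\sum_(0 <= k < n) \int[P]_w (D k w)%:E + (v n setT)%:E <=
      (v 0 setT + series beta n)%:E)%E.
    move=> h; apply: le_trans (le_trans _ h) _; first by rewrite leeDl// lee_fin.
    by rewrite lee_fin lerD2l series_ge0_le_lim.
  elim: n => [|n ih]; first by rewrite big_geq// add0e /series /= big_geq// addr0.
  rewrite big_nat_recr//= seriesS_add.
  have := stepD n; move: ih; rewrite -(fineK (DE n)).
  have -> : (\sum_(0 <= k < n) \int[P]_w (D k w)%:E =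
     (\sum_(0 <= k < n) fine (\int[P]_w (D k w)%:E)%E)%:E)%E.
    by rewrite -sumEFin; apply: eq_bigr => k _; rewrite fineK.
  rewrite -!EFinD !lee_fin; lra.
have intS : (\int[P]_w (\sum_(k <oo) (D k w)%:E) < +oo)%E.
  rewrite integral_nneseries//; last by move=> n w _; rewrite lee_fin.
  apply: le_lt_trans (ltry (v 0 setT + limn (series beta))).
  apply: lime_le; last by apply: nearW => n; exact: sumD.
  by apply: is_cvg_nneseries => n _ _; apply: integral_ge0 => w _; rewrite lee_fin.
have S0 w : (0 <= \sum_(k <oo) (D k w)%:E)%E by apply: nneseries_ge0 => n _ _; rewrite lee_fin.
have /integrable_ae : P.-integrable setT (fun w => \sum_(k <oo) (D k w)%:E)%E.
  apply/integrableP; split.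
    by apply: ge0_emeasurable_sum => n; [move=> w _ _; rewrite lee_fin|move=> _; exact: mD].
  by under eq_integral do rewrite gee0_abs//.
move=> /(_ measurableT); apply: filterS => w /(_ Logic.I) Sfin.
apply: (@cvg_series_cvg_0 _ _ (D ^~ w)).
apply: nondecreasing_is_cvgn; first by apply: nondecreasing_series.
exists (fine (\sum_(k <oo) (D k w)%:E)%E) => _ [n _ <-].
rewrite -lee_fin fineK// /series /= -sumEFin.
by apply: nneseries_lim_ge => k _ _; rewrite lee_fin.
Qed.

End supermartingale.

(** * From extended series indexed from 1 to real series *)

Lemma eseries_pinfty_series (R : realType) (u : R^nat) :
  (forall n, 0 <= u n.+1) -> (\sum_(1 <= n <oo) (u n)%:E = +oo)%E ->
  series (u \o S) @ \oo --> +oo.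
Proof.
move=> u0 uoo; have nd : nondecreasing_seq (series (u \o S)).
  by apply: nondecreasing_series => n _ _; exact: u0.
apply: nondecreasing_dvgn_lt => // cu.
suff : (\sum_(1 <= n <oo) (u n)%:E <= (limn (series (u \o S)))%:E)%E by rewrite uoo.
apply: lime_le; first by apply: is_cvg_nneseries => -[//|n] _ _; rewrite lee_fin.
apply: nearW => -[|n]; rewrite sumEFin lee_fin.
  by rewrite big_geq// (le_trans _ (nondecreasing_cvgn_le nd cu 0))// /series/= big_geq.
by rewrite big_add1/=; exact: (nondecreasing_cvgn_le nd cu n).
Qed.

Lemma eseries_lt_pinfty_series (R : realType) (u : R^nat) :
  (forall n, 0 <= u n.+1) -> (\sum_(1 <= n <oo) (u n)%:E < +oo)%E ->
  cvgn (series (u \o S)).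
Proof.
move=> u0 uoo; apply: nondecreasing_is_cvgn.
  by apply: nondecreasing_series => n _ _; exact: u0.
have un0 n : (1 <= n)%N -> (0 <= (u n)%:E)%E by case: n => // n _; rewrite lee_fin.
have uf : (\sum_(1 <= n <oo) (u n)%:E)%E \is a fin_num.
  by rewrite ge0_fin_numE//; apply: nneseries_ge0 => n + _; exact: un0.
exists (fine (\sum_(1 <= n <oo) (u n)%:E)%E) => _ [n _ <-].
rewrite -lee_fin fineK// /series /= -(big_add1 _ _ 0 n.+1 xpredT u) -sumEFin.
by apply: nneseries_lim_ge => k + _; exact: un0.
Qed.

(** * Mean squared distance after one trial step from a fixed point *)

Section trial_mean.
Context (R : realType) (H : normedModType R) (dot : {dot H for idfun}).
Hypothesis H_separable : separable H.
Hypothesis norm_dot : forall x : H, `|x| = Num.sqrt (dot x x).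
Context d (T : measurableType d) (mu : probability T R).

(** The expanded square is integrated term by term, the cross term by [bochner_dot]; the first
    moment this requires is dominated by 1 plus the second. *)
Lemma trial_mean (y v : H) (g : T -> H) (t M : R) :
  bochner_integral_is mu g v -> (\int[mu]_z (`|g z| ^+ 2)%:E <= M%:E)%E ->
  (\int[mu]_z (`|y - t *: g z| ^+ 2)%:E <=
    (`|y| ^+ 2 - 2 * t * dot y v + t ^+ 2 * M)%:E)%E.
Proof.
move=> bg gM; have mg := bg.1.
have mn : measurable_fun setT (fun z => `|g z|).
  apply: (measurableT_comp (f := fun h : borelType H => `|(h : H)|)) => //.
  by apply: continuous_measurable_real; exact: norm_continuous.
have mn2 : measurable_fun setT (fun z => (`|g z| ^+ 2)%:E).
  by apply/measurable_EFinP; exact: measurable_funX.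
have ig2 : mu.-integrable setT (fun z => (`|g z| ^+ 2)%:E).
  apply/integrableP; split => //; apply: le_lt_trans (ltry M).
  by under eq_integral do rewrite gee0_abs ?lee_fin ?sqr_ge0//.
have ig : (\int[mu]_z (`|g z|)%:E < +oo)%E.
  apply: (@le_lt_trans _ _ (\int[mu]_z (1%:E + (`|g z| ^+ 2)%:E))%E).
    apply: ge0_le_integral => //.
    - exact/measurable_EFinP.
    - exact: emeasurable_funD.
    - move=> z _; rewrite -EFinD lee_fin; have := sqr_ge0 (`|g z| - 1); nra.
  rewrite ge0_integralD//.
  rewrite integral_cst//= probability_setT mule1 lte_add_pinfty ?ltry//.
  exact: le_lt_trans gM (ltry M).
have [idot dotE] := bochner_dot H_separable norm_dot y bg ig.
have icst : mu.-integrable setT (fun=> (`|y| ^+ 2)%:E).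
  exact: finite_measure_integrable_cst.
rewrite (eq_integral (fun z => ((`|y| ^+ 2)%:E + (- (2 * t))%:E * (dot y (g z))%:E)
    + (t ^+ 2)%:E * (`|g z| ^+ 2)%:E)%E); last first.
  by move=> z _; rewrite (normBZ_sqr norm_dot) -!EFinM -!EFinD mulNr.
have iZd := integrableZl measurableT (- (2 * t)) idot.
have iZ2 := integrableZl measurableT (t ^+ 2) ig2.
rewrite integralD//; last exact: integrableD.
rewrite integralD// !integralZl// dotE integral_cst//= probability_setT mule1.
have := gM; rewrite -(fineK (integrable_fin_num measurableT ig2)).
rewrite -!EFinM -!EFinD !lee_fin mulNr lerD2l => ?.
by rewrite ler_wpM2l// sqr_ge0.
Qed.

End trial_mean.

(** * The algorithm *)

Section trust_region.
Context (R : realType) (H : normedModType R) (Omega chi : Type).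
Variables (F : H * chi -> H) (a : nat -> R) (U0 U1 : set H).
Variables (Z : nat -> Omega -> chi) (Xr X Xt : nat -> Omega -> H).
Variables (sigma : nat -> Omega -> nat) (xs : H) (R0 R1 : R).
Hypothesis algorithm : fixed_trust_region F a U0 U1 Z Xr X Xt sigma.
Hypothesis U0_U1 : U0 `<=` U1.
Hypothesis R0_lt_R1 : R0 < R1.
Hypothesis U0_ball : U0 `<=` ball xs R0.
Hypothesis ball_U1 : ball xs R1 `<=` U1.

Lemma iterate_in_U1 n w : U1 (X n w).
Proof.
case: n => [|n]; first exact/U0_U1/(ftr_init algorithm).
have [U1t|U1t] := pselect (U1 (Xt n.+1 w)).
  by have [-> _] := ftr_accept algorithm U1t.
by have [-> _] := ftr_truncate algorithm U1t; exact/U0_U1/(ftr_restart algorithm).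
Qed.

Lemma truncation_gap n w : ~ U1 (Xt n.+1 w) ->
  R1 ^+ 2 - R0 ^+ 2 <= `|Xt n.+1 w - xs| ^+ 2 - `|X n.+1 w - xs| ^+ 2.
Proof.
move=> U1t; have [XE _] := ftr_truncate algorithm U1t.
have XR0 : `|X n.+1 w - xs| < R0.
  have := U0_ball (ftr_restart algorithm (sigma n w) w).
  by rewrite -XE -ball_normE/= distrC.
have XR1 : R1 <= `|Xt n.+1 w - xs|.
  rewrite leNgt; apply/negP => lt1; apply: U1t; apply: ball_U1.
  by rewrite -ball_normE/= distrC.
have R00 : 0 <= R0 by rewrite (le_trans _ (ltW XR0)).
have R10 : 0 <= R1 by rewrite (le_trans R00)// ltW.
by rewrite lerB// ler_sqr ?nnegrE// ltW.
Qed.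

Lemma dist_le_trial n w : `|X n.+1 w - xs| ^+ 2 <= `|Xt n.+1 w - xs| ^+ 2.
Proof.
have [U1t|U1t] := pselect (U1 (Xt n.+1 w)).
  by have [-> _] := ftr_accept algorithm U1t.
have := truncation_gap U1t.
have : 0 <= R0.
  have := U0_ball (ftr_init algorithm w); rewrite -ball_normE/= => /ltW.
  exact: le_trans.
by have := R0_lt_R1; nra.
Qed.

(** Each truncation opens a gap of at least [R1 ^+ 2 - R0 ^+ 2], so vanishing gaps forbid
    truncations from some [N] on, and [sigma N] bounds the counter. *)
Lemma truncations_finite w :
  (`|Xt n.+1 w - xs| ^+ 2 - `|X n.+1 w - xs| ^+ 2) @[n --> \oo] --> 0 ->
  (ereal_sup [set (sigma n w)%:R%:E | n in [set: nat]] < +oo :> \bar R)%E.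
Proof.
(* The ball of radius [R0] contains the initial point; nonnegativity makes squaring preserve
   [R0 < R1]. *)
have R00 : 0 <= R0.
  have := U0_ball (ftr_init algorithm w); rewrite -ball_normE/= => /ltW.
  exact: le_trans.
have c0 : 0 < R1 ^+ 2 - R0 ^+ 2 by have := R0_lt_R1; nra.
move=> /cvgrPdist_lt/(_ _ c0)[N _ gapN].
have accept n : (N <= n)%N -> sigma n.+1 w = sigma n w.
  move=> Nn; have [U1t|U1t] := pselect (U1 (Xt n.+1 w)).
    by have [_] := ftr_accept algorithm U1t.
  have := truncation_gap U1t; have := gapN n Nn.
  rewrite /= sub0r normrN => /(le_lt_trans (ler_norm _)) => lt1 /le_lt_trans/(_ lt1).
  by rewrite ltxx.
have sigmaS n : (sigma n w <= sigma n.+1 w)%N.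
  have [U1t|U1t] := pselect (U1 (Xt n.+1 w)).
    by have [_ ->] := ftr_accept algorithm U1t.
  by have [_ ->] := ftr_truncate algorithm U1t.
have sigma_le n : (sigma n w <= sigma N w)%N.
  have [nN|/ltnW Nn] := leqP n N.
    exact: (homo_leq (f := sigma ^~ w) leqnn leq_trans).
  rewrite -(subnKC Nn); elim: (n - N)%N => [|k ih]; first by rewrite addn0.
  by rewrite addnS accept ?leq_addr.
apply: le_lt_trans (ltry (sigma N w)%:R).
apply: ub_ereal_sup => _ [n _ <-].
by rewrite lee_fin ler_nat.
Qed.

End trust_region.

(** * Almost sure convergence and finiteness of the truncations *)

Theorem theorem2p1
  (R : realType)
  (* H is a separable Hilbert space with inner product dot *)
  (H : completeNormedModType R) (dot : {dot H for idfun})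
  (norm_dot : forall x : H, `|x| = Num.sqrt (dot x x))
  (H_separable : separable H)
  (* the field and its mean *)
  (dchi : measure_display) (chi : measurableType dchi)
  (muZ : probability chi R)
  (F : H * chi -> H)
  (F_measurable :
    measurable_fun [set: borelType H * chi] (F : borelType H * chi -> borelType H))
  (f : H -> H)
  (f_mean : forall x, bochner_integral_is muZ (fun z => F (x, z)) (f x))
  (* the noise *)
  (dOmega : measure_display) (Omega : measurableType dOmega)
  (P : probability Omega R)
  (Z : nat -> {RV P >-> chi})
  (Z_law : forall n B, measurable B -> distribution P (Z n.+1) B = muZ B)
  (Z_indep : mutually_independent P (fun n : nat => Z n.+1 : Omega -> chi))
  (* the algorithm *)
  (a : nat -> R) (U0 U1 : set H)
  (U0_open : open U0) (U1_open : open U1)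
  (U0_bounded : bounded_set U0) (U1_bounded : bounded_set U1)
  (U0_proper : U0 `<` U1)
  (Xr X Xt : nat -> Omega -> H) (sigma : nat -> Omega -> nat)
  (algorithm : fixed_trust_region F a U0 U1 Z Xr X Xt sigma)
  (X0_measurable : measurable_fun [set: Omega] (X 0%N : Omega -> borelType H))
  (X0_indep : independent_sigma P
    (g_sigma_algebra_preimage (X 0%N : Omega -> borelType H)) (sigma_noise Z))
  (X_adapted : forall n,
    g_sigma_algebra_preimage (X n : Omega -> borelType H) `<=`
    sigma_history (X 0%N) Z n)
  (* (1) *)
  (xs : H) (f_zero : f xs = 0)
  (R0 R1 : R) (R0_lt_R1 : R0 < R1)
  (U0_ball : U0 `<=` ball xs R0)
  (ball_ball : ball xs R0 `<=` ball xs R1)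
  (ball_U1 : ball xs R1 `<=` U1)
  (* (2) *)
  (f_drift : forall r A : R, 0 < r -> r < A ->
    exists2 delta : R, 0 < delta &
      (delta%:E <= ereal_inf [set (dot (x - xs) (f x))%:E | x in
         [set x | U1 x /\ (r <= `|x - xs| <= A)%R]])%E)
  (* (3) *)
  (F_moment2 : exists M : R, forall x, U1 x ->
    (\int[muZ]_z (`|F (x, z)| ^+ 2)%:E <= M%:E)%E)
  (* (4) *)
  (a_gt0 : forall n, (1 <= n)%N -> 0 < a n)
  (a_sum : (\sum_(1 <= n <oo) (a n)%:E = +oo)%E)
  (a_sum2 : (\sum_(1 <= n <oo) (a n ^+ 2)%:E < +oo)%E) :
  {ae P, forall w, X n w @[n --> \oo] --> xs} /\
  {ae P, forall w, (ereal_sup [set (sigma n w)%:R%:E | n in [set: nat]] < +oo :> \bar R)%E}.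
Proof.
have U0_U1 : U0 `<=` U1 by have [] := U0_proper.
have X_U1 := iterate_in_U1 algorithm U0_U1.
have [M FM] := F_moment2.
have M0 : 0 <= M.
  rewrite -lee_fin; apply: le_trans (FM _ (X_U1 0%N point)).
  by apply: integral_ge0 => z _; rewrite lee_fin sqr_ge0.
have [K K_gt0 U1K] : exists2 K, 0 < K & forall x, U1 x -> `|x - xs| <= K.
  have [C [_ U1C]] := U1_bounded.
  (* Boundedness holds for every constant strictly above [C], hence the 1; [|xs|] accounts for
     recentering at [xs]. *)
  exists (`|C| + 1 + `|xs|) => [|x U1x]; first by rewrite ltr_pwDl// ltr_wpDl.
  rewrite (le_trans (ler_normB _ _))// lerD2r; apply: U1C => //.
  by rewrite (le_lt_trans (ler_norm C))// ltrDl.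
have driftU r : 0 < r -> exists2 delta, 0 < delta & forall x, U1 x ->
    delta * (r <= `|x - xs| ^+ 2)%R%:R <= dot (x - xs) (f x).
  move=> r0.
  have inf_le s : 0 < s -> exists2 delta, 0 < delta & forall x, U1 x ->
      s <= `|x - xs| -> delta <= dot (x - xs) (f x).
    (* The outer radius [s + K] exceeds [s] and covers all of [U1]. *)
    move=> s0; have [|delta delta0 di] := f_drift s (s + K) s0; first by rewrite ltrDl.
    exists delta => // x U1x sx; rewrite -lee_fin; apply: le_trans di _.
    apply: ereal_inf_lbound; exists x => //; split => //; rewrite sx /=.
    by rewrite (le_trans (U1K _ U1x))// lerDr ltW.
  have s0 : 0 < Num.sqrt r by rewrite sqrtr_gt0.
  have [delta delta0 dd] := inf_le _ s0; exists delta => // x U1x.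
  have [rx|xr] := leP r (`|x - xs| ^+ 2).
    rewrite mulr1; apply: dd => //.
    by rewrite -ler_sqr ?nnegrE ?sqrtr_ge0// sqr_sqrtr// ltW.
  (* Below the level only nonnegativity is claimed; away from [xs] it comes from the annulus of
     inner radius [|x - xs|] itself. *)
  rewrite mulr0; have [->|xxs] := eqVneq x xs; first by rewrite subrr linear0l.
  have [|d0 d00 /(_ x U1x (lexx _))] := inf_le `|x - xs|.
    by rewrite normr_gt0 subr_eq0.
  by apply: le_trans; exact: ltW.
have mZ n : measurable_fun setT (Z n) by exact: measurable_funP.
pose G n := sigma_history (X 0%N) Z n.
have G_meas n B : G n B -> measurable B by exact: measurable_history.
have GX n A : measurable (A : set (borelType H)) -> G n (X n @^-1` A).
  by move=> mA; apply: X_adapted; exists A; rewrite ?setTI.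
have mX n : measurable_fun setT (X n : Omega -> borelType H).
  by move=> _ A mA; rewrite setTI; apply: (G_meas n); exact: GX.
pose V n w := `|X n w - xs| ^+ 2.
pose W n w := `|Xt n.+1 w - xs| ^+ 2.
(* The squared trial distance as a function of current point and fresh noise, the form that freezing
   requires. *)
pose phi n (x : borelType H * chi) :=
  `|((x.1 : H) - xs) - a n.+1 *: F ((x.1 : H), x.2)| ^+ 2.
have mphi n : measurable_fun setT (phi n).
  apply: measurable_funX; apply: measurable_dist => //.
    apply: (measurableT_comp (f := fun h : borelType H => ((h : H) - xs) : borelType H)) => //.
    by apply: continuous_borel => h; apply: cvgB; [exact: cvg_id|exact: cvg_cst].
  apply: (measurableT_comp (f := fun h : borelType H => (a n.+1 *: (h : H)) : borelType H)).
    by apply: continuous_borel; exact: scaler_continuous.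
  by rewrite (_ : (fun x => _) = F)//; apply/funext => -[].
have WE n w : W n w = phi n (X n w, Z n.+1 w).
  by rewrite /W /phi (ftr_trial algorithm) addrAC.
have mV n : measurable_fun setT (V n).
  apply: measurable_funX; apply: measurable_dist => //; exact: measurable_cst.
have mW n : measurable_fun setT (W n).
  rewrite (_ : W n = fun w => phi n (X n w, Z n.+1 w)); last exact/funext/WE.
  by apply: (measurableT_comp (mphi n)); exact: measurable_fun_pair.
have V_adapted n t : G n [set w | V n w < t].
  have mdist : measurable_fun setT (fun x : borelType H => `|(x : H) - xs| ^+ 2).
    by apply: measurable_funX; apply: measurable_dist => //; exact: measurable_cst.
  have := GX n _ (mdist measurableT _ (measurable_itv `]-oo, t[)).
  by rewrite setTI; congr (G n _); apply/seteqP; split => w /=; rewrite in_itv.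
pose alpha n := a n.+1.
pose beta n := a n.+1 ^+ 2 * M.
have a0 n : 0 < alpha n by exact: a_gt0.
have beta0 n : 0 <= beta n by rewrite mulr_ge0// sqr_ge0.
have G_I n A B : G n A -> G n B -> G n (A `&` B).
  exact: (@measurableI _ (g_sigma_algebraType (g_sigma_algebra_preimage
    (X 0%N : Omega -> borelType H) `|`
    \bigcup_(k in [set k | (1 <= k <= n)%N]) g_sigma_algebra_preimage (Z k)))).
have V0 n w : 0 <= V n w by exact: sqr_ge0.
have drift r : 0 < r -> exists2 delta, 0 < delta & forall n B, G n B ->
    (\int[P]_(w in B) (W n w)%:E + (alpha n * delta)%:E * P (B `&` [set w | (r <= V n w)%R])
     <= \int[P]_(w in B) (V n w)%:E + (beta n)%:E)%E.
  move=> r0; have [delta delta0 dU] := driftU r r0.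
  (* The 2 comes from the cross term of the expanded square. *)
  exists (2 * delta) => [|n B GB]; first by rewrite mulr_gt0.
  have mB := G_meas _ _ GB.
  have mge : measurable [set w | r <= V n w].
    rewrite (_ : [set w | _] = ~` [set w | V n w < r]); first exact/measurableC/(G_meas n).
    by apply/seteqP; split => w /=; rewrite leNgt => /negP.
  have mEphi : measurable_fun setT (EFin \o phi n) by exact/measurable_EFinP.
  have mEV : measurable_fun B (EFin \o V n).
    by apply/measurable_EFinP; exact: measurable_funTS.
  (* [B] intersected with an event of [X n] stays in the history, hence is independent of [Z n.+1],
     whose law is [muZ]. *)
  have freeze : (\int[P]_(w in B) (W n w)%:E =
      \int[P]_(w in B) \int[muZ]_z (phi n (X n w, z))%:E)%E.
    under eq_integral do rewrite WE.
    have := @integral_freezing _ _ _ P _ (borelType H) _ chi (X n) (Z n.+1) muZ B (EFin \o phi n).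
    apply => //.
      move=> A C mA mC.
      have := history_indep mZ Z_indep X0_measurable X0_indep (G_I _ _ _ GB (GX n A mA)) mC.
      by move=> ->; rewrite -(Z_law n C mC).
    by move=> x; rewrite lee_fin sqr_ge0.
  (* The inequality is proved pointwise in [w], an indicator standing for the event of the drift
     term, before integrating over [B]. *)
  have inner w : (\int[muZ]_z (phi n (X n w, z))%:E +
      (alpha n * (2 * delta))%:E * (\1_[set w | r <= V n w] w)%:E <= (V n w)%:E + (beta n)%:E)%E.
    have := trial_mean H_separable norm_dot (X n w - xs) (a n.+1)
      (f_mean (X n w)) (FM _ (X_U1 n w)).
    move=> /(leeD2r ((alpha n * (2 * delta))%:E * (\1_[set w | r <= V n w] w)%:E)).
    move/le_trans; apply; rewrite -!EFinM -!EFinD lee_fin indicE.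
    have := dU _ (X_U1 n w).
    have -> : (w \in [set w | r <= V n w]) = (r <= V n w).
      by apply/idP/idP; rewrite inE.
    move/(ler_wpM2l (ltW (a0 n))); rewrite /V /beta /alpha; lra.
  have mI : measurable_fun B (fun w => \int[muZ]_z (phi n (X n w, z))%:E)%E.
    apply: measurable_funTS.
    apply: (measurableT_comp (f := fubini_F muZ (EFin \o phi n))) => //.
    by apply: measurable_fun_fubini_tonelli_F => // x; rewrite lee_fin sqr_ge0.
  have mInd : measurable_fun B (fun w => (\1_[set w | r <= V n w] w)%:E : \bar R).
    by apply/measurable_EFinP; apply: measurable_funTS; exact: measurable_indic.
  have c0 : 0 <= alpha n * (2 * delta) by rewrite mulr_ge0 ?(ltW (a0 n))// mulr_ge0// ltW.
  apply: (@le_trans _ _ (\int[P]_(w in B) ((V n w)%:E + (beta n)%:E))%E); last first.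
    rewrite ge0_integralD//; last 2 first.
    - by move=> w _; rewrite lee_fin.
    - by move=> w _; rewrite lee_fin.
    rewrite leeD2l// integral_cst// -[leRHS]mule1 lee_wpmul2l ?probability_le1//.
    by rewrite lee_fin.
  rewrite freeze setIC -integral_indic// -ge0_integralZl//.
  have term1_ge0 w : (0 <= \int[muZ]_z (phi n (X n w, z))%:E)%E.
    by apply: integral_ge0 => z _; rewrite lee_fin sqr_ge0.
  have term2_ge0 w : (0 <= (alpha n * (2 * delta))%:E * (\1_[set w | r <= V n w] w)%:E)%E.
    by rewrite mule_ge0 ?lee_fin.
  have mterm2 : measurable_fun B
      (fun w => (alpha n * (2 * delta))%:E * (\1_[set w | r <= V n w] w)%:E)%E.
    exact: measurable_funeM.
  rewrite -ge0_integralD//.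
  apply: ge0_le_integral => //.
  - by move=> w _; rewrite adde_ge0.
  - exact: emeasurable_funD.
  - exact: emeasurable_funD.
have U1d n w : V n.+1 w <= W n w.
  exact: (dist_le_trial algorithm R0_lt_R1 U0_ball ball_U1).
have VK n w : V n w <= K ^+ 2 by rewrite ler_sqr ?nnegrE ?U1K// ltW.
have G_mono n : G n `<=` G n.+1 by exact: sub_history.
have G_T n : G n setT.
  by rewrite -(preimage_setT (X n)); exact: GX.
have alpha_sum : series alpha @ \oo --> +oo.
  by apply: eseries_pinfty_series => // n; exact: ltW (a0 n).
have beta_sum : cvgn (series beta).
  rewrite (_ : beta = M *: ((fun n => a n ^+ 2) \o S)).
    apply: is_cvg_seriesZ; apply: eseries_lt_pinfty_series a_sum2 => n.
    exact: sqr_ge0.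
  by apply/funext => n; rewrite /beta mulrC.
split.
  have := supermartingale_cvg0 mV mW V0 VK U1d G_meas G_T G_I G_mono V_adapted
    (fun n => ltW (a0 n)) beta0 alpha_sum beta_sum drift.
  apply: filterS => w Vw; apply/cvgrPdist_lt => e e0.
  have e20 : 0 < e ^+ 2 by rewrite exprn_gt0.
  move/cvgrPdist_lt : Vw => /(_ _ e20); apply: filterS => n.
  by rewrite sub0r normrN ger0_norm// /V distrC ltr_sqr ?nnegrE// ltW.
have := supermartingale_gap_cvg0 mV mW V0 VK U1d G_T
  (fun n => ltW (a0 n)) beta0 beta_sum drift.
apply: filterS => w.
exact: (truncations_finite algorithm R0_lt_R1 U0_ball ball_U1).
Qed.
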